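(* Let $k\ge3$, $q\ge2$ and $L\ge2$ be integers, and let $H=(V,E)$ be a finite $k$-uniform hypergraph of girth greater than $L$, with no isolated vertices, such that, writing $N=|V|$: (1) every $U\subseteq V$ with $|U|\ge N/q$ contains a hyperedge; (2) every nonempty $S\subseteq V$ with $|S|\le(1-1/q)N$ has a hyperedge meeting it in exactly one vertex. Let $G$ be any abelian group and let $g:V\to G$ have at most $q$ distinct values. If there is a fixed $b\in G$ with $$\sum_{v\in e}g(v)=b\quad\text{for every }e\in E,$$ then $g$ is constant.
   Context: A $k$-uniform hypergraph $H=(V,E)$ consists of a vertex set $V$ and a set $E$ of $k$-element subsets of $V$ (hyperedges). A vertex is isolated if it lies in no hyperedge. Girth means Berge girth: a cycle of length $\ell\ge2$ consists of $\ell$ distinct vertices $v_1,\dots,v_\ell$ and $\ell$ distinct hyperedges $e_1,\dots,e_\ell$ with $v_i,v_{i+1}\in e_i$ for all $i$ (indices cyclic). The girth is the length of a shortest cycle, or infinity if there is none. *)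

(* Defs.v *)
From mathcomp Require Import all_boot all_order all_algebra.
From mathcomp Require Import boolp.
Set Implicit Arguments.
Unset Strict Implicit.
Unset Printing Implicit Defensive.

Section Hypergraph.
Variable V : finType.

Definition uniform (k : nat) (E : {set {set V}}) : Prop :=
  forall e, e \in E -> #|e| = k.

Definition isolated (E : {set {set V}}) (x : V) : Prop :=
  forall e, e \in E -> x \notin e.

(* [ordS] is the cyclic successor on ['I_l]. *)
Definition has_berge_cycle (E : {set {set V}}) (l : nat) : Prop :=
  2 <= l /\
  exists (v : 'I_l -> V) (e : 'I_l -> {set V}),
    [/\ injective v, injective e, forall i, e i \in E &
        forall i, v i \in e i /\ v (ordS i) \in e i].

Lemma has_berge_cycle_asbool (E : {set {set V}}) :
  (exists l, has_berge_cycle E l) -> exists l, `[< has_berge_cycle E l >].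
Proof. by case=> l El; exists l; apply/asboolP. Qed.

(* [None] stands for infinite girth. *)
Definition girth (E : {set {set V}}) : option nat :=
  match pselect (exists l, has_berge_cycle E l) with
  | left cyc => Some (ex_minn (has_berge_cycle_asbool cyc))
  | right _ => None
  end.

Definition girth_gt (E : {set {set V}}) (L : nat) : Prop :=
  if girth E is Some l then L < l else True.

Lemma girth_gtP (E : {set {set V}}) (L : nat) :
  girth_gt E L <-> forall l, has_berge_cycle E l -> L < l.
Proof.
rewrite /girth_gt /girth; case: pselect => [cyc|ncyc]; last first.
  by split=> // _ l El; case: ncyc; exists l.
case: ex_minnP => m /asboolP Em min_m; split=> [Lm l El|]; last exact.
by apply: leq_trans Lm _; apply/min_m/asboolP.
Qed.

End Hypergraph.

(* Main.v *)
Require Import Defs.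
From mathcomp Require Import all_boot all_order all_algebra.
Import GRing.Theory Num.Theory.
Local Open Scope ring_scope.

(** Call the level sets of [g] its colour classes. There are at most [q] of
    them, so one, for a value [a], has at least [N / q] vertices
    ([large_fibre]) and contains a hyperedge; summing [g] over that hyperedge
    identifies [b] as [k] times [a]. The translate [h v = g v - a] then sums to
    zero over every hyperedge, by uniformity.

    The support [S] of [h] is the complement of the large class, hence has at
    most [(1 - 1/q) N] vertices. A hyperedge meeting [S] in a single vertex
    would have [h]-sum equal to the nonzero value of [h] there
    ([sum_single_support]), so [S] is empty and [g] is constantly [a]. *)

(** Pigeonhole, multiplied out to stay in [nat]: if all fibres had fewer than
    [#|V| / q] points, [q] of them could not cover [V]. *)
Lemma large_fibre (V : finType) (T : eqType) (g : V -> T) (q : nat) (x : V) :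
  (size (undup (codom g)) <= q)%N ->
  exists a : T, (#|V| <= q * #|[set v | g v == a]|)%N.
Proof.
move=> gq; set s := undup (codom g).
have sum_fibres : (\sum_(a <- s) #|[set v | g v == a]| = #|V|)%N.
  transitivity (\sum_(a <- s) \sum_(v : V) (g v == a : nat))%N.
    by apply: eq_bigr => a _; rewrite -sum1dep_card big_mkcond.
  rewrite exchange_big /= -sum1_card; apply: eq_bigr => v _.
  rewrite -big_mkcond sum1_count (eq_count (a2 := pred1 (g v))); last first.
    by move=> a; rewrite /= eq_sym.
  by rewrite count_uniq_mem ?undup_uniq // mem_undup codom_f.
have [/hasP[a _ Va]|/hasPn small] :=
  boolP (has (fun a => #|V| <= q * #|[set v | g v == a]|)%N s); first by exists a.
have V_gt0 : (0 < #|V|)%N by apply/card_gt0P; exists x.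
have q_gt0 : (0 < q)%N.
  apply: leq_trans gq; rewrite -has_predT.
  by apply/hasP; exists (g x); rewrite // mem_undup codom_f.
have : (q * #|V| <= q * #|V|.-1)%N.
  rewrite -{1}sum_fibres big_distrr /=.
  apply: leq_trans (_ : size s * #|V|.-1 <= _)%N; last by rewrite leq_mul2r gq orbT.
  rewrite -sum1_size big_distrl /= big_seq [leqRHS]big_seq.
  by apply: leq_sum => a /small; rewrite -ltnNge mul1n => lt_V; rewrite -ltnS prednK.
by rewrite leq_pmul2l // -ltnS prednK // ltnn.
Qed.

Lemma sum_single_support (V : finType) (G : zmodType) (h : V -> G)
    (e : {set V}) :
  #|e :&: [set v | h v != 0]| = 1%N -> \sum_(v in e) h v != 0.
Proof.
move=> /eqP/cards1P[w eSw].
have hw : h w != 0.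
  by have := set11 w; rewrite -eSw !inE => /andP[].
rewrite (big_setID [set v | h v != 0]) /= eSw big_set1 big1 ?addr0 // => v.
by rewrite !inE negbK => /andP[/eqP].
Qed.

Theorem corollary6p2 (k q L : nat) (hk : (3 <= k)%N) (hq : (2 <= q)%N)
    (hL : (2 <= L)%N) (V : finType) (E : {set {set V}})
    (hunif : uniform k E) (hgirth : girth_gt E L)
    (hiso : forall x : V, ~ isolated E x)
    (hdense : forall U : {set V},
       #|V|%:R / q%:R <= #|U|%:R :> rat ->
       exists2 e : {set V}, e \in E & e \subset U)
    (hmeet : forall S : {set V}, S != set0 ->
       #|S|%:R <= (1 - 1 / q%:R) * #|V|%:R :> rat ->
       exists2 e : {set V}, e \in E & #|e :&: S| = 1%N)
    (G : zmodType) (g : V -> G) (hg : (size (undup (codom g)) <= q)%N)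
    (b : G) (hb : forall e : {set V}, e \in E -> \sum_(v in e) g v = b) :
  forall x y : V, g x = g y.
Proof.
move=> x y; have [a] := large_fibre _ _ g q x hg; set U := [set v | _] => Va.
have q_gt0 : (0 : rat) < q%:R by rewrite ltr0n (leq_trans _ hq).
have VU : #|V|%:R / q%:R <= #|U|%:R :> rat.
  by rewrite ler_pdivrMr // -natrM ler_nat mulnC.
have bE : b = a *+ k.
  have [e eE /subsetP eU] := hdense U VU.
  rewrite -(hb e eE) -(hunif e eE) -sumr_const; apply: eq_bigr => v /eU.
  by rewrite inE => /eqP.
pose h v := g v - a; set S := [set v | h v != 0].
have h0 e : e \in E -> \sum_(v in e) h v = 0.
  by move=> eE; rewrite sumrB hb // sumr_const (hunif e eE) bE subrr.
have SE : S = ~: U by apply/setP => v; rewrite !inE subr_eq0.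
have leS : #|S|%:R <= (1 - 1 / q%:R) * #|V|%:R :> rat.
  rewrite mulrBl !mul1r [_^-1 * _]mulrC lerBrDr SE.
  by rewrite -[in leRHS](cardsC U) natrD addrC lerD2r.
have [S0|/hmeet/(_ leS)[e eE /sum_single_support]] := eqVneq S set0; last first.
  by rewrite h0 // eqxx.
suff ga v : g v = a by rewrite !ga.
by apply/eqP; have := in_set0 v; rewrite -S0 inE subr_eq0 => /negbFE.
Qed.
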